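(* Let $G$ be a regular graph, let $\alpha_0$ be a proper $t_0$-edge-coloring of $G$, and let $D\subseteq V(G)$ be a set of vertices with $S(D,\alpha_0)\neq\emptyset$. If $def(v,\alpha_0)=0$ for every $v\in V(G)\setminus D$, then for every integer $t$ with $\max S(D,\alpha_0)-\min S(D,\alpha_0)+1\leq t\leq t_0$, the graph $G$ has a proper $t$-edge-coloring $\alpha$ such that $def(v,\alpha)=def(v,\alpha_0)$ for every vertex $v\in V(G)$.
   Context: All graphs are finite, undirected, without loops or multiple edges. A proper $t$-edge-coloring of $G$ is a map $\alpha:E(G)\to\{1,\ldots,t\}$ such that all $t$ colors are used and adjacent edges receive different colors. The spectrum $S(v,\alpha)$ of a vertex $v$ is the set of colors on edges incident to $v$, and for $D\subseteq V(G)$, $S(D,\alpha)=\bigcup_{v\in D}S(v,\alpha)$. For a finite set $A$ of integers, $def(A)=\max A-\min A-|A|+1$ ($def(\emptyset)=0$), and $def(v,\alpha)=def(S(v,\alpha))$. *)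

(* Defs.v *)
From mathcomp Require Import all_boot.
From mathcomp Require Import finmap.

Set Implicit Arguments.
Unset Strict Implicit.
Unset Printing Implicit Defensive.

Record sgraph := SGraph {
  vertex :> finType;
  adj : rel vertex;
  adj_sym : symmetric adj;
  adj_irr : irreflexive adj
}.

Section Graph.

Variable G : sgraph.

Definition edges : {set {set G}} :=
  [set [set p.1; p.2] | p in [pred p : G * G | adj p.1 p.2]].

Definition degree (v : G) : nat := #|[set u | adj v u]|.

Definition regular : Prop := exists r, forall v : G, degree v = r.

End Graph.

Section FiniteSetsOfNaturals.

Variable A : {fset nat}.

Definition max_fset : nat := \max_(c <- A) c.

(* Starting the iteration at the maximum makes this the true minimum of a
   nonempty set; both extrema of the empty set are 0. *)
Definition min_fset : nat := \big[minn/max_fset]_(c <- A) c.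

(* The subtraction of naturals does not truncate here: a nonempty A lies in
   an interval with (max - min).+1 elements. *)
Definition deficiency : nat :=
  if A == fset0 then 0 else (max_fset - min_fset).+1 - #|` A|.

End FiniteSetsOfNaturals.

Lemma bigmaxn_mem (s : seq nat) : s != [::] -> \max_(c <- s) c \in s.
Proof.
elim: s => // x s IHs _; rewrite big_cons /maxn in_cons.
case: ltnP => [lt_x|]; last by rewrite eqxx.
by rewrite IHs ?orbT //; case: s lt_x {IHs} => //; rewrite big_nil.
Qed.

Lemma max_fsetP (A : {fset nat}) : A != fset0 ->
  max_fset A \in A /\ forall c, c \in A -> c <= max_fset A.
Proof.
case/fset0Pn=> x xA; split=> [|c cA].
  by apply: bigmaxn_mem; move: (xA : x \in enum_fset A); case: (enum_fset A).
by rewrite /max_fset (big_rem c) //= leq_maxl.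
Qed.

Lemma min_fsetP (A : {fset nat}) : A != fset0 ->
  min_fset A \in A /\ forall c, c \in A -> min_fset A <= c.
Proof.
move=> A0; have [MA leM] := max_fsetP A0; rewrite /min_fset; split=> [|c].
  by rewrite big_seq; elim/big_ind: _ => // x y xA yA; rewrite /minn; case: ifP.
change (c \in A) with (c \in enum_fset A).
elim: (enum_fset A) => // x s IHs; rewrite in_cons big_cons geq_min.
by case/predU1P=> [->|/IHs ->]; rewrite ?leqnn ?orbT.
Qed.

Section Coloring.

Variable G : sgraph.

(* A coloring is a total function on vertex sets; only its values on the
   edges of G matter. *)
Implicit Type a : {set G} -> nat.

Definition proper_edge_coloring (t : nat) a : Prop :=
  [/\ forall e, e \in edges G -> 1 <= a e <= t,
      forall c, 1 <= c <= t -> exists2 e, e \in edges G & a e = c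
    & forall e f, e \in edges G -> f \in edges G ->
        e != f -> e :&: f != set0 -> a e != a f].

Definition spectrum a (v : G) : {fset nat} :=
  [fset a e | e in [set e in edges G | v \in e]]%fset.

Definition spectrum_set a (D : {set G}) : {fset nat} :=
  (\bigcup_(v in D) spectrum a v)%fset.

Definition vdef a (v : G) : nat := deficiency (spectrum a v).

End Coloring.

(* Main.v *)
(* Fix a window of t consecutive colors containing S(D, α0), and move every color
   outside it into the r extreme colors of the window on its side, keeping its
   residue mod r, where r is the degree. A vertex of D sees only colors of the
   window, which do not move. Any other vertex sees r consecutive colors, hence
   every residue mod r exactly once; these either lie in the window or meet only
   one side of its complement, and in the latter case all of them end up in the
   same r extreme colors, so they form an interval again. Translating the window
   to [1, t] gives the coloring. *)
Require Import Defs.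
From mathcomp Require Import all_boot.
From mathcomp Require Import finmap.
From mathcomp Require Import zify.

Set Implicit Arguments.
Unset Strict Implicit.
Unset Printing Implicit Defensive.

Section Deficiency.

Implicit Types (A : {fset nat}) (c s x y : nat).

Lemma max_fset_eq A x :
  x \in A -> (forall c, c \in A -> c <= x) -> max_fset A = x.
Proof.
move=> xA leAx; have /max_fsetP[MA leAM] : A != fset0 by apply/fset0Pn; exists x.
by apply/eqP; rewrite eqn_leq leAx ?leAM.
Qed.

Lemma min_fset_eq A x :
  x \in A -> (forall c, c \in A -> x <= c) -> min_fset A = x.
Proof.
move=> xA lexA; have /min_fsetP[mA lemA] : A != fset0 by apply/fset0Pn; exists x.
by apply/eqP; rewrite eqn_leq lemA ?lexA.
Qed.

Lemma card_fset_le_span A : #|` A| <= (max_fset A - min_fset A).+1.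
Proof.
have [->|A0] := eqVneq A fset0; first by rewrite cardfs0.
have [[_ leM] [_ lem]] := (max_fsetP A0, min_fsetP A0).
rewrite -[X in _ <= X](size_iota (min_fset A)).
apply: uniq_leq_size (fset_uniq A) _ => c cA.
by rewrite mem_iota; have := leM c cA; have := lem c cA; lia.
Qed.

(** This lemma and the next trade deficiency 0 for a form easier to transport: the set fits in an
    interval of as many integers as it has elements. *)
Lemma deficiency0_interval A : deficiency A = 0 ->
  forall c, c \in A -> min_fset A <= c < min_fset A + #|` A|.
Proof.
rewrite /deficiency => def0 c cA.
have A0 : A != fset0 by apply/fset0Pn; exists c.
have [[_ leM] [_ lem]] := (max_fsetP A0, min_fsetP A0).
by move: def0; rewrite (negPf A0); have := leM c cA; have := lem c cA; lia.
Qed.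

Lemma interval_deficiency0 A y :
  (forall c, c \in A -> y <= c < y + #|` A|) -> deficiency A = 0.
Proof.
rewrite /deficiency; case: ifPn => // A0 inA.
have [[/inA MA _] [/inA mA _]] := (max_fsetP A0, min_fsetP A0).
by lia.
Qed.

(** Absorbs the translation of the window at the vertices of [D]. Adding [s], unlike truncated
    subtraction, is injective. *)
Lemma deficiency_shift s A : deficiency [fset (c + s)%N | c in A]%fset = deficiency A.
Proof.
have [->|A0] := eqVneq A fset0; first by rewrite imfset0.
have [[MA leM] [mA lem]] := (max_fsetP A0, min_fsetP A0).
rewrite /deficiency card_imfset /=; last by move=> c c' /addIn.
have MB : max_fset [fset (c + s)%N | c in A]%fset = max_fset A + s.
  apply: max_fset_eq; first by apply/imfsetP; exists (max_fset A).
  by move=> _ /imfsetP[c /= cA ->]; rewrite leq_add2r leM.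
have mB : min_fset [fset (c + s)%N | c in A]%fset = min_fset A + s.
  apply: min_fset_eq; first by apply/imfsetP; exists (min_fset A).
  by move=> _ /imfsetP[c /= cA ->]; rewrite leq_add2r lem.
rewrite MB mB subnDr (negPf A0) ifN //.
by apply/fset0Pn; exists (max_fset A + s); apply/imfsetP; exists (max_fset A).
Qed.

End Deficiency.

Lemma modn_inj_interval r y c c' :
  y <= c < y + r -> y <= c' < y + r -> c = c' %[mod r] -> c = c'.
Proof.
wlog le_cc' : c c' / c' <= c => [wl|] yc yc' /eqP.
  by case/orP: (leq_total c' c) => le /eqP e; [|apply/esym]; apply: wl.
rewrite eqn_mod_dvd // => /dvdn_leq; lia.
Qed.

Section Fold.

Variables r s t : nat.
Hypotheses (r_gt0 : 0 < r) (le_rt : r <= t).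

(* Moves [c] into the window [s + 1, s + t] preserving its residue mod [r],
   then translates by [- s]. *)
Definition fold_color c :=
  if c <= s then r - (s - c) %% r
  else if c <= s + t then c - s
  else (t - r) + ((c - (s + t)).-1 %% r).+1.

Lemma fold_color_window c : s < c <= s + t -> fold_color c = c - s.
Proof. by case/andP=> sc ct; rewrite /fold_color leqNgt sc ct. Qed.

Lemma fold_color_bounds c : 1 <= fold_color c <= t.
Proof.
rewrite /fold_color.
have := ltn_pmod (s - c) r_gt0; have := ltn_pmod (c - (s + t)).-1 r_gt0.
by case: ifP => ?; [|case: ifP => ?]; lia.
Qed.

Lemma fold_color_mod c : fold_color c + s = c %[mod r].
Proof.
rewrite /fold_color; case: ifPn => [le_cs|lt_sc].
  have lt_r := ltn_pmod (s - c) r_gt0.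
  (* Undoing the translation, a color below the window has moved up by a whole number of periods
     [r]. *)
  have -> : r - (s - c) %% r + s = ((s - c) %/ r).+1 * r + c.
    by have := divn_eq (s - c) r; lia.
  by rewrite modnMDl.
case: ifPn => [le_ct|lt_ct]; first by congr (_ %% r); lia.
(* [d] counts from the first color above the window, [s + t + 1], which moves down by exactly one
   period. *)
set d := _.-1; have eq_d := divn_eq d r.
have eq_c : c = (d %/ r).+1 * r + (t - r + (d %% r).+1 + s) by lia.
by rewrite [in RHS]eq_c modnMDl.
Qed.

Lemma fold_color_inj_interval y c c' :
  y <= c < y + r -> y <= c' < y + r -> fold_color c = fold_color c' -> c = c'.
Proof.
move=> yc yc' eq_cc'; apply: (modn_inj_interval yc yc').
by rewrite -fold_color_mod eq_cc' fold_color_mod.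
Qed.

(** As [r <= t], [r] consecutive colors cannot meet both sides of the window. If some may lie below
    it, all images are in [[1, r]]; if some lie above, in [[t - r + 1, t]]; otherwise the interval
    is only translated. *)
Lemma fold_color_interval y :
  exists z, forall c, y <= c < y + r -> z <= fold_color c < z + r.
Proof.
have bounds c := (ltn_pmod (s - c) r_gt0, ltn_pmod (c - (s + t)).-1 r_gt0).
have [le_ys|lt_sy] := leqP y s.
  exists 1 => c yc; have [] := bounds c; rewrite /fold_color.
  by case: ifP => ?; [|case: ifP => ?]; lia.
have [le_yt|lt_ty] := leqP (y + r) (s + t).+1.
  by exists (y - s) => c yc; rewrite fold_color_window; lia.
exists (t - r).+1 => c yc; have [] := bounds c; rewrite /fold_color.
by case: ifP => ?; [|case: ifP => ?]; lia.
Qed.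

End Fold.

Section Spectrum.

Variable G : sgraph.
Implicit Types (a : {set G} -> nat) (v : G) (e : {set G}).

Lemma spectrumP a v c :
  reflect (exists e, [/\ e \in edges G, v \in e & c = a e]) (c \in spectrum a v).
Proof.
apply: (iffP (imfsetP _ _ _ _)) => [[e /=]|[e [eG ve ->]]].
  by rewrite inE => /andP[eG ve] ->; exists e.
by exists e; rewrite //= inE eG.
Qed.

Lemma spectrum_comp a (g : nat -> nat) v :
  spectrum (g \o a) v = [fset g c | c in spectrum a v]%fset.
Proof.
apply/fsetP=> c; apply/spectrumP/imfsetP.
  case=> e [eG ve ->].
  by exists (a e) => //; apply/spectrumP; exists e.
by case=> _ /spectrumP[e [eG ve ->]] ->; exists e.
Qed.

Lemma card_incident_edges v : #|[set e in edges G | v \in e]| = degree v.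
Proof.
have -> : [set e in edges G | v \in e] = [set [set v; u] | u in [set u | adj v u]].
  apply/setP=> e; rewrite inE; apply/andP/imsetP=> [[/imsetP[[x y] /= xy ->]]|[u]].
    rewrite !inE in xy *; case/orP=> /eqP->; first by exists y; rewrite ?inE.
    by exists x; rewrite ?inE 1?adj_sym // setUC.
  rewrite inE => vu ->; rewrite set21; split=> //.
  by apply/imsetP; exists (v, u).
(* If [u] lies in [[set v; u']], then [u = u'], since [u = v] would give a loop. *)
apply: card_in_imset => u u'; rewrite !inE => vu vu' /setP/(_ u).
rewrite !inE eqxx orbT => /esym/orP[]/eqP // uv.
by move: vu; rewrite uv adj_irr.
Qed.

Lemma card_spectrum a t v : proper_edge_coloring t a -> #|` spectrum a v| = degree v.
Proof.
case=> _ _ prop; rewrite -card_incident_edges card_in_imfset /=; first by rewrite cardE.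
move=> e f; rewrite !inE => /andP[eG ve] /andP[fG vf] aef.
apply: contraTeq (eqxx (a e)) => ef; rewrite {2}aef; apply: prop => //.
by apply/set0Pn; exists v; rewrite inE ve.
Qed.

(** Adjacent edges share a vertex, so a recoloring [g] only has to be injective on each spectrum,
    and may merge colors globally. *)
Lemma proper_edge_coloring_comp a t0 t (g : nat -> nat) :
  proper_edge_coloring t0 a ->
  (forall c, 1 <= g c <= t) ->
  (forall c, 1 <= c <= t -> exists2 c0, 1 <= c0 <= t0 & g c0 = c) ->
  (forall v, {in spectrum a v &, injective g}) ->
  proper_edge_coloring t (g \o a).
Proof.
move=> [_ surj prop] g_bounds g_surj g_inj; split=> [e _ | c /g_surj | e f eG fG ef].
- exact: g_bounds.
- by case=> c0 /surj[e eG <-] <-; exists e.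
case/set0Pn=> v /setIP[ve vf].
have ef0 : e :&: f != set0 by apply/set0Pn; exists v; rewrite inE ve.
apply: contraNneq (prop e f eG fG ef ef0) => /(g_inj v) -> //.
  by apply/spectrumP; exists e.
by apply/spectrumP; exists f.
Qed.

End Spectrum.

Theorem theorem2p5 (G : sgraph) (t0 : nat) (a0 : {set G} -> nat) (D : {set G}) :
  regular G ->
  proper_edge_coloring t0 a0 ->
  spectrum_set a0 D <> fset0 ->
  (forall v : G, v \notin D -> vdef a0 v = 0) ->
  forall t : nat,
    (max_fset (spectrum_set a0 D) - min_fset (spectrum_set a0 D)).+1 <= t <= t0 ->
    exists a : {set G} -> nat,
      proper_edge_coloring t a /\ forall v : G, vdef a v = vdef a0 v.
Proof.
case=> r degG col0 /eqP SD0 def0 t.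
have [[MSD leM] [mSD lem]] := (max_fsetP SD0, min_fsetP SD0).
set M := max_fset _ in MSD leM *; set m := min_fset _ in mSD lem *.
case/andP=> le_t le_t0.
have card_r v : #|` spectrum a0 v| = r by rewrite (card_spectrum _ col0) degG.
have subSD v c : v \in D -> c \in spectrum a0 v -> m <= c <= M.
  move=> vD cv; suff cSD : c \in spectrum_set a0 D by rewrite lem ?leM.
  by apply/bigfcupP; exists v; rewrite ?vD ?mem_index_enum.
have bounds0 v c : c \in spectrum a0 v -> 1 <= c <= t0.
  by case/spectrumP=> e [eG _ ->]; case: col0 => + _ _; apply.
have [v0 v0D mv0] : exists2 v, v \in D & m \in spectrum a0 v.
  by case/bigfcupP: mSD => v /andP[_ vD] mv; exists v.
have [v1 v1D Mv1] : exists2 v, v \in D & M \in spectrum a0 v.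
  by case/bigfcupP: MSD => v /andP[_ vD] Mv; exists v.
have r_gt0 : 0 < r by rewrite -(card_r v0) cardfs_gt0; apply/fset0Pn; exists m.
(* The vertex [v0] sees [r] distinct colors, all between [m] and [M]. *)
have le_rt : r <= t.
  have v0n0 : spectrum a0 v0 != fset0 by apply/fset0Pn; exists m.
  have [[Mv0 _] [mv0' _]] := (max_fsetP v0n0, min_fsetP v0n0).
  have := card_fset_le_span (spectrum a0 v0); rewrite card_r.
  by have := subSD _ _ v0D Mv0; have := subSD _ _ v0D mv0'; lia.
have m_bounds := bounds0 _ _ mv0; have M_bounds := bounds0 _ _ Mv1.
(* The largest [s] for which the window [[s + 1, s + t]] starts no later than [m] and ends no later
   than [t0]. *)
pose s := minn m.-1 (t0 - t).
have [lt_sm le_Mst le_st0] : [/\ s < m, M <= s + t & s + t <= t0] by split; lia.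
pose g := fold_color r s t.
have gD v c : v \in D -> c \in spectrum a0 v -> s < c /\ g c = c - s.
  move=> vD /(subSD _ _ vD) mcM; split; first by lia.
  by apply: fold_color_window; lia.
have intD v : v \notin D ->
    exists y, forall c, c \in spectrum a0 v -> y <= c < y + r.
  move=> /def0/deficiency0_interval int_v.
  by exists (min_fset (spectrum a0 v)) => c /int_v; rewrite card_r.
have g_inj v : {in spectrum a0 v &, injective g}.
  move=> c c' cv cv'; have [vD|/intD[y int_v]] := boolP (v \in D).
    have [sc ->] := gD _ _ vD cv; have [sc' ->] := gD _ _ vD cv'.
    by lia.
  by apply: (@fold_color_inj_interval _ _ _ r_gt0 le_rt y); apply: int_v.
exists (g \o a0); split=> [|v].
  apply: proper_edge_coloring_comp col0 _ _ g_inj => [c|c c_t].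
    exact: fold_color_bounds.
  (* The window lies in [[1, t0]], so [a0] uses all its colors. *)
  by exists (c + s); [lia | rewrite /g fold_color_window; lia].
rewrite /vdef spectrum_comp; have [vD|vD] := boolP (v \in D).
  (* At a vertex of [D], shifting the new spectrum back by [s] gives the old one. *)
  rewrite -(deficiency_shift s) -imfset_comp; congr deficiency.
  have eqc c : c \in spectrum a0 v -> g c + s = c.
    by move=> /(gD _ _ vD)[sc ->]; rewrite subnK // ltnW.
  apply/fsetP=> c; apply/imfsetP/idP=> [[c' /= cv ->]|cv]; first by rewrite eqc.
  by exists c; rewrite //= eqc.
have [y int_v] := intD v vD.
rewrite [RHS](def0 v vD).
have [z int_z] := fold_color_interval s r_gt0 le_rt y.
(* Injectivity on the spectrum leaves [r] distinct colors among [r] consecutive ones. *)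
apply: (@interval_deficiency0 _ z) => _ /imfsetP[c /= /int_v/int_z cz ->].
by rewrite card_in_imfset; [rewrite card_r | apply: g_inj].
Qed.
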